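(* Let $X\subset \mathbb{P}^N$ be an irreducible projective variety over $\mathbb{C}$ whose generic $X$-Hadamard-rank $\mathrm{Hrk}_X^\circ$ is finite, and let $\mathbf{x} = (x_0:\cdots:x_N) \in \mathbb{P}^N$ be any point such that $\prod_{i} x_i \neq 0$. Then $\mathrm{Hrk}_X(\mathbf{x})\leq 2 \cdot \mathrm{Hrk}_X^\circ$.
   Context: Homogeneous coordinates on $\mathbb{P}^N=\mathbb{P}^N_{\mathbb{C}}$ are fixed. The Hadamard product of points is $(p_0:\cdots:p_N)\star(q_0:\cdots:q_N)=(p_0q_0:\cdots:p_Nq_N)$, defined whenever the right-hand side is not identically zero. The $X$-Hadamard-rank $\mathrm{Hrk}_X(p)$ of $p\in\mathbb{P}^N$ is the smallest $m\ge 1$ such that $p=q_1\star\cdots\star q_m$ with $q_i\in X$ (and $\infty$ if there is none). Let $\eta_m(X)$ be the Zariski closure of $\{p\in\mathbb{P}^N : \mathrm{Hrk}_X(p)\le m\}$. The generic $X$-Hadamard-rank $\mathrm{Hrk}_X^\circ$ is the smallest $m\ge1$ such that $\eta_m(X)=\mathbb{P}^N$, and $\infty$ if no such $m$ exists. *)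

(* Defs.v *)
From HB Require Import structures.
(* [mpoly] comes first and without its notations: they clash with those of
   [classical_sets], and its [symmetric] would hide the one on relations. *)
From mathcomp Require Import -(notations) mpoly.
From mathcomp Require Import all_boot all_order all_algebra generic_quotient.
From mathcomp Require Import complex.
From mathcomp Require Import boolp classical_sets reals constructive_ereal.

Set Implicit Arguments.
Unset Strict Implicit.
Unset Printing Implicit Defensive.

Import GRing.Theory Num.Theory.
Local Open Scope classical_set_scope.
Local Open Scope ring_scope.
Local Open Scope complex_scope.
Local Open Scope quotient_scope.

Section ProjectiveSpace.
Variables (R : realType) (N : nat).

Definition nzvec := {v : 'rV[R[i]]_N.+1 | v != 0}.

Definition proportional : rel nzvec :=
  fun u v => `[< exists2 c : R[i], c != 0 & val u = c *: val v >].

Lemma proportional_refl : reflexive proportional.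
Proof. by move=> u; apply/asboolP; exists 1; rewrite ?oner_neq0 ?scale1r. Qed.

Lemma proportional_sym : symmetric proportional.
Proof.
suff s u v : proportional u v -> proportional v u.
  by move=> u v; apply/idP/idP; exact: s.
case/asboolP=> c c0 uv; apply/asboolP; exists c^-1; first by rewrite invr_eq0.
by rewrite uv scalerA mulVf // scale1r.
Qed.

Lemma proportional_trans : transitive proportional.
Proof.
move=> v u w /asboolP[c c0 uv] /asboolP[d d0 vw]; apply/asboolP.
by exists (c * d); rewrite ?mulf_neq0 // uv vw scalerA.
Qed.

Canonical proportional_equiv := EquivRel proportional
  proportional_refl proportional_sym proportional_trans.

Definition proj := {eq_quot proportional}.

HB.instance Definition _ := Choice.on proj.
HB.instance Definition _ := Quotient.on proj.
HB.instance Definition _ := EqQuotient.on proj.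

(* Homogeneous coordinates come from an arbitrary but fixed representative; the
   lemmas [coordsP], [vanishes_pi], [hadamard_pi] and [coords_prod_pi] show that
   nothing below depends on that choice. *)
Definition coords (p : proj) : 'rV[R[i]]_N.+1 := val (repr p).

Definition point_of (v : 'rV[R[i]]_N.+1) : option proj :=
  omap (fun u : nzvec => \pi_proj u) (insub v).

Definition hadamard (p q : proj) : option proj :=
  point_of (\row_i (coords p 0 i * coords q 0 i)).

Definition hadamard_seq (s : seq proj) : option proj :=
  if s is p :: s' then
    foldl (fun o q => obind (fun r => hadamard r q) o) (Some p) s'
  else None.

Definition vanishes (f : mpoly N.+1 R[i]) (p : proj) : Prop :=
  meval (coords p 0) f = 0.

Definition homogeneous (f : mpoly N.+1 R[i]) : Prop :=
  exists d, f \is ishomog1 d mdeg.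

Definition zariski_closed (Z : set proj) : Prop :=
  exists2 I : set (mpoly N.+1 R[i]), I `<=` homogeneous &
    Z = [set p | forall f, I f -> vanishes f p].

Definition zariski_closure (S : set proj) : set proj :=
  smallest zariski_closed S.

Definition irreducible_variety (X : set proj) : Prop :=
  [/\ zariski_closed X, X !=set0 &
      forall Y Z : set proj, zariski_closed Y -> zariski_closed Z ->
        X = Y `|` Z -> X = Y \/ X = Z].

(* The least element of a set of naturals, with [+oo] for the empty set. *)
Definition least (P : set nat) : \bar R :=
  if pselect (exists n, `[< P n >]) is left exP
  then (ex_minn exP)%:R%:E else +oo%E.

Definition Hrk (X : set proj) (p : proj) : \bar R :=
  least [set m | (1 <= m)%N /\
    exists q : m.-tuple proj,
      (forall i, X (tnth q i)) /\ hadamard_seq q = Some p].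

Definition eta (m : nat) (X : set proj) : set proj :=
  zariski_closure [set p | (Hrk X p <= m%:R%:E)%E].

Definition generic_Hrk (X : set proj) : \bar R :=
  least [set m | (1 <= m)%N /\ eta m X = setT].

Lemma coordsP (u : nzvec) :
  exists2 c : R[i], c != 0 & coords (\pi_proj u) = c *: val u.
Proof.
have : \pi_proj (repr (\pi_proj u)) == \pi_proj u by rewrite reprK.
by rewrite piE => /asboolP.
Qed.

Lemma coords_neq0 (p : proj) : coords p != 0.
Proof. exact: valP (repr p). Qed.

Lemma point_of_scale (c : R[i]) (v : 'rV[R[i]]_N.+1) :
  c != 0 -> point_of (c *: v) = point_of v.
Proof.
move=> c0; rewrite /point_of; case: (boolP (v == 0)) => [/eqP->|v0].
  by rewrite scaler0.
have cv0 : c *: v != 0 by rewrite scaler_eq0 negb_or c0.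
rewrite (insubT (fun w => w != 0) v0) (insubT (fun w => w != 0) cv0) /=.
  congr Some; apply/eqP.
by rewrite piE; apply/asboolP; exists c.
Qed.

Lemma hadamard_pi (u v : nzvec) :
  hadamard (\pi_proj u) (\pi_proj v) =
  point_of (\row_i (val u 0 i * val v 0 i)).
Proof.
have [c c0 cu] := coordsP u; have [d d0 dv] := coordsP v.
rewrite -(@point_of_scale (c * d)) ?mulf_neq0 // /hadamard cu dv.
by congr point_of; apply/rowP => i; rewrite !mxE mulrACA.
Qed.

Lemma vanishes_pi (f : mpoly N.+1 R[i]) (u : nzvec) :
  homogeneous f ->
  vanishes f (\pi_proj u) <-> meval (val u 0) f = 0.
Proof.
case=> d /dhomogP hf; have [c c0 cu] := coordsP u.
suff -> : vanishes f (\pi_proj u) = (c ^+ d * meval (val u 0) f = 0).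
  by split=> [/eqP|->]; rewrite ?mulr0 // mulf_eq0 expf_eq0 (negPf c0) andbF => /eqP.
rewrite /vanishes cu; congr (_ = 0); rewrite !mevalE mulr_sumr.
apply: eq_big_seq => m /hf <-.
rewrite mulrCA; congr (_ * _).
rewrite /= mdegE -prodrXr -big_split /=; apply: eq_bigr => i _.
by rewrite mxE exprMn.
Qed.

Lemma coords_prod_pi (u : nzvec) :
  (\prod_i coords (\pi_proj u) 0 i != 0) = (\prod_i val u 0 i != 0).
Proof.
have [c c0 ->] := coordsP u.
under eq_bigr do rewrite mxE.
by rewrite big_split /= prodr_const mulf_eq0 expf_eq0 (negPf c0) andbF.
Qed.

End ProjectiveSpace.

(* Main.v *)
Require Import Defs.
From mathcomp Require Import -(notations) mpoly.
From mathcomp Require Import all_boot all_order all_algebra.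
From mathcomp Require Import generic_quotient closed_field.
From mathcomp Require Import complex.
From mathcomp Require Import boolp classical_sets reals constructive_ereal.

(** Work with vectors of homogeneous coordinates, and let P_k be the set of
    coordinatewise products of k vectors on the affine cone over X.  A point
    has rank at most m exactly when it is represented by a vector of P_k for
    some k with 1 <= k <= m.

    The heart of the proof is that P_k is constructible, being the image of an
    algebraic set under a polynomial map (Chevalley); in the form used here
    ([image_generically_decided]), either P_k or its complement contains the
    locus where some nonzero polynomial g does not vanish.  Let m be the
    generic rank.  If the second case held for every k <= m, then the points of
    rank at most m would all lie on one hypersurface, against their density
    ([zariski_dense_generic]).  So some P_k with k <= m contains a nonempty
    open set.  For x in the torus, u |-> x / u is an automorphism of the torus,
    so a generic u satisfies both u \in P_k and x / u \in P_k
    ([generically_divide]), and x = u * (x / u) is a product of 2k <= 2m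
    points of X.

    Chevalley's theorem comes from quantifier elimination over an
    algebraically closed field: a quantifier-free formula is a boolean
    combination of polynomial equations, and each equation is either an
    identity or generically false ([formula_generically_decided]).  For the
    image to be described by a formula, X must be cut out by finitely many
    equations; this is Hilbert's basis theorem ([noetherian_mpoly],
    [finite_equations]). *)

Set Implicit Arguments.
Unset Strict Implicit.
Unset Printing Implicit Defensive.

Import Order.TTheory GRing.Theory Num.Theory.

Local Open Scope classical_set_scope.
Local Open Scope ring_scope.

Local Notation "{ 'mpoly' K [ n ] }" := (mpoly n K).
Local Notation "''X_' i" := (mpolyX _ (mnm1 i)).
Local Notation "p .@[ v ]" := (meval v p).

(** * Hilbert's basis theorem *)

Section Ideals.
Variable A : comNzRingType.
Implicit Types (I J : set A) (a b : A) (s : seq A).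

Definition ideal J :=
  [/\ J 0, forall a b, J a -> J b -> J (a + b) & forall c a, J a -> J (c * a)].

Local Notation span I := (smallest ideal I).

Lemma span_ideal I : ideal (span I).
Proof.
split=> [J [] [] //|a b Ia Ib J IJ|c a Ia J IJ].
  by case: (IJ) => -[_ JD _] _; apply: JD; [exact: Ia | exact: Ib].
by case: (IJ) => -[_ _ JM] _; apply: JM; exact: Ia.
Qed.

Lemma span_mono I J : I `<=` J -> span I `<=` span J.
Proof. by apply: sub_smallest2r; exact: span_ideal. Qed.

(** Generators are taken inside the given set, not merely inside the ideal that
    it generates, so that finitely many of the given equations suffice. *)
Definition noetherian :=
  forall I, exists2 s : seq _, [set` s] `<=` I & I `<=` span [set` s].

(** The elements that depend on finitely many generators form an ideal. *)
Lemma span_finite I a :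
  span I a -> exists2 s : seq _, [set` s] `<=` I & span [set` s] a.
Proof.
move: a; apply: smallest_sub => [|a Ia]; last first.
  exists [:: a] => [b /=|]; first by rewrite inE => /eqP->.
  by apply: sub_gen_smallest; exact: mem_head.
split=> [|a b [s sI sa] [t tI tb]|c a [s sI sa]].
- by exists [::] => //; case: (span_ideal [set` Nil A]).
- exists (s ++ t) => [d /=|]; first by rewrite mem_cat => /orP[/sI|/tI].
  have [_ spanD _] := span_ideal [set` s ++ t].
  apply: spanD; [move: sa|move: tb]; apply: span_mono => d /= ds;
    by rewrite mem_cat ds ?orbT.
by exists s => //; have [_ _ spanM] := span_ideal [set` s]; exact: spanM.
Qed.

Lemma spans_finite I s : [set` s] `<=` span I ->
  exists2 t : seq _, [set` t] `<=` I & [set` s] `<=` span [set` t].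
Proof.
elim: s => [|a s IHs] sI; first by exists [::].
have [t tI st] := IHs (fun b bs => sI b (mem_behead (s := a :: s) bs)).
have [u uI au] := span_finite (sI a (mem_head a s)).
exists (u ++ t) => [d /=|d /=]; first by rewrite mem_cat => /orP[/uI|/tI].
rewrite inE => /orP[/eqP->|/st]; [move: au|]; apply: span_mono => b /= bs;
  by rewrite mem_cat bs ?orbT.
Qed.

End Ideals.

Local Notation span I := (smallest (@ideal _) I).

(** Asking only for a set-theoretic section covers quotients and isomorphic
    copies alike: lift the generators, then push forward the membership. *)
Lemma noetherian_retract (A B : comNzRingType) (phi : {rmorphism A -> B})
    (sigma : B -> A) :
  cancel sigma phi -> noetherian A -> noetherian B.
Proof.
move=> sigmaK noethA I.
have [s sI Is] := noethA (sigma @` I).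
exists (map phi s) => [_ /= /mapP[a /sI[b Ib <-] ->]|b Ib].
  by rewrite sigmaK.
rewrite -[b]sigmaK.
have : span [set` s] (sigma b) by apply: Is; exists b.
move: (sigma b); apply: (smallest_sub (X := phi @^-1` span [set` map phi s])).
  have [h0 hD hM] := span_ideal [set` map phi s].
  split=> [|a c|c a]; rewrite /preimage /= ?rmorph0 ?rmorphD ?rmorphM //.
    exact: hD.
  exact: hM.
by move=> a /= sa; apply: sub_gen_smallest => /=; rewrite map_f.
Qed.

Lemma noetherian_field (K : fieldType) : noetherian K.
Proof.
move=> I; have [[a Ia a0]|I0] := pselect (exists2 a, I a & a != 0).
  exists [:: a] => [b /=|b Ib]; first by rewrite inE => /eqP->.
  have [_ _ hM] := span_ideal [set` [:: a]].
  rewrite -[b](mulfVK a0); apply: hM.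
  by apply: sub_gen_smallest; exact: mem_head.
exists [::] => // b Ib; have [h0 _ _] := span_ideal [set` Nil K].
by have [->|b0] := eqVneq b 0; last by case: I0; exists b.
Qed.

Section HilbertBasis.
Variable A : comNzRingType.
Hypothesis noethA : noetherian A.

Lemma minimal_degree (I : set {poly A}) (s : seq {poly A}) :
  (exists2 p, I p & ~ span [set` s] p) ->
  exists p, [/\ I p, ~ span [set` s] p &
    forall q, I q -> ~ span [set` s] q -> (size p <= size q)%N].
Proof.
case=> p Ip np; have [k] := ubnP (size p).
elim: k => // k IHk in p Ip np *; rewrite ltnS => pk.
have [[q [Iq nq qp]]|minp] :=
    pselect (exists q, [/\ I q, ~ span [set` s] q & (size q < size p)%N]).
  by apply: (IHk q) => //; exact: leq_trans qp pk.
exists p; split=> // q Iq nq; rewrite leqNgt; apply/negP => qp.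
by apply: minp; exists q.
Qed.

(** Multiplying by powers of the variable brings all the generators to the same
    degree d, so a combination of leading coefficients is again the coefficient
    of degree d of a combination of the polynomials. *)
Lemma span_coef (I : set {poly A}) (d : nat) :
  (forall p, I p -> (size p <= d.+1)%N) ->
  span [set lead_coef p | p in I] `<=`
  [set a | exists p, [/\ span I p, (size p <= d.+1)%N & p`_d = a]].
Proof.
move=> Id; have [h0 hD hM] := span_ideal I; apply: smallest_sub.
  split=> [|_ _ [p [Ip pd <-]] [q [Iq qd <-]]|c _ [p [Ip pd <-]]].
  - by exists 0; split; rewrite ?size_poly0 ?coef0.
  - exists (p + q); split; [exact: hD| |by rewrite coefD].
    by rewrite (leq_trans (size_polyD _ _)) // geq_max pd.
  - exists (c%:P * p); split; [exact: hM| |by rewrite coefCM].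
    by rewrite mul_polyC (leq_trans (size_scale_leq _ _)).
move=> _ [p Ip <-]; have [->|p0] := eqVneq p 0.
  by exists 0; split; rewrite ?size_poly0 ?coef0 ?lead_coef0.
have pd := Id p Ip; have sp : (0 < size p)%N by rewrite size_poly_gt0.
have szd : ((d.+1 - size p) + (size p).-1 = d)%N.
  by apply/eqP; rewrite -eqSS -addnS prednK // subnK.
exists ('X^(d.+1 - size p) * p); split.
- by apply: hM; exact: sub_gen_smallest.
- by rewrite (leq_trans (size_polyMleq _ _)) // size_polyXn addSn /= subnK.
- rewrite coefXnM -[X in (X < _)%N]szd -[X in p`_(X - _)]szd.
  by rewrite ltnNge leq_addr addKn.
Qed.

(** Hilbert's basis theorem.  If the ideal of I had no finite set of generators,
    one could choose g_0, g_1, ... in it, each of minimal degree outside the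
    ideal of its predecessors.  The leading coefficient of some g_m depends on
    the previous ones, so subtracting from g_m a combination of the previous
    polynomials lowers its degree, against minimality. *)
Theorem noetherian_poly : noetherian {poly A}.
Proof.
move=> I; apply: contrapT => noI.
pose fresh (s : seq {poly A}) p := [/\ span I p, ~ span [set` s] p &
    forall q, span I q -> ~ span [set` s] q -> (size p <= size q)%N].
have [next nextP] : {next : seq {poly A} -> {poly A} &
    forall s, [set` s] `<=` span I -> fresh s (next s)}.
  apply: (@boolp.choice _ _
    (fun s p => [set` s] `<=` span I -> fresh s p)) => s.
  have [sI|] := pselect ([set` s] `<=` span I); last by exists 0.
  have [t tI st] := spans_finite sI.
  have [p Ip np] : exists2 p, I p & ~ span [set` t] p.
    apply: contrapT => h; apply: noI; exists t => // p Ip.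
    by apply: contrapT => np; apply: h; exists p.
  have [|q hq] := @minimal_degree (span I) s; last by exists q.
  exists p; first exact: sub_gen_smallest.
  by move=> /(smallest_sub (span_ideal _) st).
pose fix S n := if n is n'.+1 then rcons (S n') (next (S n')) else [::].
pose g n := next (S n).
have SS n : S n.+1 = rcons (S n) (g n) by [].
have SE n p : p \in S n <-> exists2 i, (i < n)%N & p = g i.
  elim: n => [|n IHn]; first by split=> // -[].
  rewrite SS mem_rcons in_cons; split=> [/orP[/eqP->|/IHn[i lein ->]]|[i ]].
  - by exists n.
  - by exists i => //; exact: leqW.
  - rewrite ltnS leq_eqVlt => /orP[/eqP[->] ->|lin pg]; first by rewrite eqxx.
    by rewrite orbC IHn.2 //; exists i.
have SI n : [set` S n] `<=` span I.
  elim: n => [|n IHn] p //=; rewrite -/(S n) mem_rcons inE.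
  move=> /orP[/eqP->|/IHn//].
  by have [] := nextP _ IHn.
have gP n : fresh (S n) (g n) by exact: nextP.
have g_mono i n : (i <= n)%N -> (size (g i) <= size (g n))%N.
  move=> lein; have [_ _ gmin] := gP i; have [gI gn _] := gP n.
  apply: gmin => // gi; apply: gn; move: gi.
  apply: span_mono => p /= /SE[j lji ->].
  by apply/SE; exists j => //; exact: leq_trans lein.
have [s sL Ls] := noethA [set lead_coef (g n) | n in setT].
have [m sm] : exists m, forall a, a \in s ->
    exists2 i, (i < m)%N & lead_coef (g i) = a.
  elim: s sL {Ls} => [|a s IHs] sL; first by exists 0%N.
  have [m sm] := IHs (fun b bs => sL b (mem_behead (s := a :: s) bs)).
  have [n _ na] := sL a (mem_head a s).
  exists (maxn m n.+1) => b; rewrite inE => /orP[/eqP->|/sm[i im ib]].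
    by exists n => //; rewrite leq_max ltnSn orbT.
  by exists i => //; rewrite leq_max im.
have [gI gn gmin] := gP m; have [h0 hD hM] := span_ideal [set` S m].
have [J0 JD JM] := span_ideal I.
have gm0 : g m != 0 by apply/eqP => gm0; apply: gn; rewrite gm0.
have szg : (size (g m)).-1.+1 = size (g m) by rewrite prednK ?size_poly_gt0.
have [p [pS pd pl]] : exists p, [/\ span [set` S m] p,
    (size p <= (size (g m)).-1.+1)%N & p`_(size (g m)).-1 = lead_coef (g m)].
  apply: (@span_coef [set` S m]).
    by move=> _ /= /SE[i im ->]; rewrite szg; apply/g_mono/ltnW.
  have : span [set` s] (lead_coef (g m)) by apply: Ls; exists m.
  apply: span_mono => a /sm[i im <-]; exists (g i) => //=.
  by apply/SE; exists i.
rewrite szg in pd.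
have /gmin : span I (g m - p).
  rewrite -[- p]mulN1r; apply: JD => //; apply: JM.
  exact: (smallest_sub (span_ideal I) (SI m)) pS.
have ngp : ~ span [set` S m] (g m - p).
  by move=> gp; apply: gn; rewrite -[g m](subrK p); exact: hD.
move=> /(_ ngp); rewrite leqNgt => /negP[].
rewrite -szg ltnS; apply/leq_sizeP => j.
rewrite leq_eqVlt => /orP[/eqP<-|lj]; first by rewrite coefB pl subrr.
rewrite coefB !nth_default ?subrr //; first by rewrite (leq_trans pd) // -szg.
by rewrite -szg.
Qed.

End HilbertBasis.

(** * Multivariate polynomials: finite systems and nonvanishing *)

Section LastVariable.
Variables (A : comNzRingType) (n : nat).

(** The inverse of [muni], packaged as a ring morphism so that it can transport
    ideals. *)
Definition poly_mpoly : {rmorphism {poly {mpoly A[n]}} -> {mpoly A[n.+1]}} :=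
  horner_morph (fun p => mulrC ('X_ord_max : {mpoly A[n.+1]}) (mwiden p)).

Lemma muniK : cancel (@muni n A) poly_mpoly.
Proof.
move=> p; rewrite muniE raddf_sum [RHS]mpolyE; apply: eq_bigr => m _.
rewrite -mul_polyC /= /horner_morph rmorphM hornerM /=.
rewrite map_polyC map_polyXn hornerC hornerXn /=.
rewrite mwidenZ mwidenX -scalerAl; congr (_ *: _).
rewrite mpolyXn -mpolyXD; congr mpolyX; apply/mnmP => i.
rewrite mnmDE mulmnE mnm1E.
have [k ->|->] := unliftP ord_max i.
  have -> : lift ord_max k = widen_ord (leqnSn n) k.
    by apply/val_inj; rewrite /= /bump leqNgt ltn_ord.
  by rewrite mnmwiden_widen mnmE -val_eqE /= gtn_eqF // addn0.
by rewrite mnmwiden_ordmax eqxx mul1n.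
Qed.

End LastVariable.

Lemma noetherian_mpoly (K : fieldType) (n : nat) : noetherian {mpoly K[n]}.
Proof.
elim: n => [|n IHn]; last first.
  exact: (noetherian_retract (@muniK K n) (noetherian_poly IHn)).
pose const : {rmorphism K -> {mpoly K[0]}} := @mpolyC 0 K.
apply: (noetherian_retract (phi := const) (sigma := mcoeff mnm0)).
  by move=> p; exact/esym/nvar0_mpolyC.
exact: noetherian_field.
Qed.

Lemma span_vanish (A : comNzRingType) n (v : 'I_n -> A) (I : set {mpoly A[n]}) :
  I `<=` [set f | f.@[v] = 0] -> span I `<=` [set f | f.@[v] = 0].
Proof.
apply: smallest_sub; split=> [|f g|c f] /=; first exact: meval0.
  by rewrite mevalD => -> ->; rewrite addr0.
by rewrite mevalM => ->; rewrite mulr0.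
Qed.

(** The polynomials that vanish at v form an ideal, so they include I as soon as
    they include a finite basis of it. *)
Lemma finite_equations (K : fieldType) n (I : set {mpoly K[n]}) :
  exists2 s : seq {mpoly K[n]}, [set` s] `<=` I &
    forall v : 'I_n -> K, (forall f, f \in s -> f.@[v] = 0) ->
      forall f, I f -> f.@[v] = 0.
Proof.
have [s sI Is] := noetherian_mpoly I; exists s => // v sv f /Is.
by apply: (span_vanish (I := [set` s])).
Qed.

Lemma meval_mwiden (A : comNzRingType) n (w : 'I_n.+1 -> A) (f : {mpoly A[n]}) :
  (mwiden f).@[w] = f.@[w \o widen_ord (leqnSn n)].
Proof.
rewrite [f]mpolyE (raddf_sum (@mwiden n A)) !raddf_sum /=.
apply: eq_bigr => m _.
rewrite mwidenZ mwidenX !mevalZ !mevalX big_ord_recr /= mnmwiden_ordmax mulr1.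
by congr (_ * _); apply: eq_bigr => i _; rewrite mnmwiden_widen.
Qed.

Lemma meval_muni (A : comNzRingType) n (w : 'I_n.+1 -> A)
    (p : {mpoly A[n.+1]}) :
  p.@[w] =
  (map_poly (meval (w \o widen_ord (leqnSn n))) (muni p)).[w ord_max].
Proof.
rewrite -{1}[p]muniK /= /horner_morph.
rewrite -(mevalXU w ord_max) -horner_map -map_poly_comp; congr horner.
by apply: eq_map_poly => f /=; rewrite meval_mwiden.
Qed.

(** By induction, specialise the leading coefficient in the last variable to a
    nonzero value; the resulting polynomial in one variable has finitely many
    roots. *)
Lemma mpoly_nonroot (K : closedFieldType) n (p : {mpoly K[n]}) :
  p != 0 -> exists v : 'I_n -> K, p.@[v] != 0.
Proof.
elim: n p => [|n IHn] p p0.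
  by exists (fun=> 0); move: p0; rewrite [p]nvar0_mpolyC mevalC mpolyC_eq0.
have : muni p != 0.
  by apply: contra_neq p0 => /(congr1 (@poly_mpoly K n)); rewrite muniK rmorph0.
rewrite -lead_coef_eq0 => /IHn[v]; rewrite lead_coefE => vp.
have /(closed_nonrootP)[t] : map_poly (meval v) (muni p) != 0.
  apply: contraNneq vp => /(congr1 (fun q : {poly K} => q`_(size (muni p)).-1)).
  by rewrite coef_map coef0 => ->.
rewrite rootE => pt.
exists (fun i => if unlift ord_max i is Some j then v j else t).
rewrite meval_muni unlift_none.
rewrite (_ : map_poly _ _ = map_poly (meval v) (muni p)) //.
apply: eq_map_poly => f; apply: meval_eq => i /=.
have -> : widen_ord (leqnSn n) i = lift ord_max i.
  by apply/val_inj; rewrite /= /bump leqNgt ltn_ord.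
by rewrite liftK.
Qed.

(** * Definable sets are generically decided *)

Section Generic.
Variables (K : closedFieldType) (n : nat).
Implicit Types (P Q : set ('I_n -> K)) (v : 'I_n -> K).

(** P contains a nonempty Zariski-open subset of the affine space. *)
Definition generically P :=
  exists2 g : {mpoly K[n]}, g != 0 & forall v, g.@[v] != 0 -> P v.

Definition generically_decided P := generically P \/ generically (~` P).

Lemma generically_setT : generically setT.
Proof. by exists 1; rewrite ?oner_neq0. Qed.

Lemma generically_sub P Q : P `<=` Q -> generically P -> generically Q.
Proof. by move=> PQ [g g0 gP]; exists g => // v /gP/PQ. Qed.

Lemma generically_setI P Q :
  generically P -> generically Q -> generically (P `&` Q).
Proof.
move=> [g g0 gP] [h h0 hQ]; exists (g * h); first exact: mulf_neq0.
by move=> v; rewrite mevalM mulf_eq0 negb_or => /andP[/gP Pv /hQ].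
Qed.

Lemma generically_nonempty P : generically P -> P !=set0.
Proof. by case=> g /mpoly_nonroot[v gv] /(_ v gv); exists v. Qed.

Definition env v : seq K := [seq v i | i <- enum 'I_n].

Lemma nth_env v (i : 'I_n) : (env v)`_i = v i.
Proof. by rewrite (nth_map i) ?nth_ord_enum // size_enum_ord. Qed.

Lemma term_mpoly (t : GRing.term K) : GRing.rterm t ->
  exists p : {mpoly K[n]}, forall v, GRing.eval (env v) t = p.@[v].
Proof.
elim: t => //=.
- move=> i _; have [lt_in|le_ni] := ltnP i n.
    exists 'X_(Ordinal lt_in) => v; rewrite mevalXU.
    exact: (nth_env v (Ordinal lt_in)).
  by exists 0 => v; rewrite meval0 nth_default // size_map size_enum_ord.
- by move=> c _; exists (mpolyC n c) => v; rewrite mevalC.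
- by move=> k _; exists k%:R => v; rewrite rmorph_nat.
- move=> t IHt u IHu /andP[/IHt[p tp] /IHu[q uq]].
  by exists (p + q) => v; rewrite mevalD tp uq.
- by move=> t IHt /IHt[p tp]; exists (- p) => v; rewrite mevalN tp.
- by move=> t IHt k /IHt[p tp]; exists (p *+ k) => v; rewrite mevalMn tp.
- move=> t IHt u IHu /andP[/IHt[p tp] /IHu[q uq]].
  by exists (p * q) => v; rewrite mevalM tp uq.
- by move=> t IHt k /IHt[p tp]; exists (p ^+ k) => v; rewrite rmorphXn tp.
Qed.

(** An equation p = q holds everywhere if p - q is the zero polynomial, and
    fails wherever p - q does not vanish otherwise.  Boolean connectives
    preserve the dichotomy because two nonempty open sets meet. *)
Lemma qf_generically_decided (f : GRing.formula K) :
    GRing.qf_form f -> GRing.rformula f ->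
  generically_decided [set v | GRing.qf_eval (env v) f].
Proof.
elim: f => //=.
- move=> b _ _; have gT := generically_setT.
  by case: b; [left|right]; apply: generically_sub gT.
- move=> t u _ /andP[/term_mpoly[p tp] /term_mpoly[q uq]].
  have [pq|pq] := eqVneq (p - q) 0; [left|right].
    apply: generically_sub generically_setT => v _ /=.
    by rewrite tp uq (subr0_eq pq).
  exists (p - q) => // v; rewrite mevalB subr_eq0 /= tp uq.
  exact/negP.
- move=> f IHf h IHh /andP[qf qh] /andP[rf rh].
  case: (IHf qf rf) => [gf|gf]; last first.
    by right; apply: generically_sub gf => v /= nf /andP[].
  case: (IHh qh rh) => [gh|gh]; last first.
    by right; apply: generically_sub gh => v /= nh /andP[].
  by left; apply: generically_sub (generically_setI gf gh) => v /= [-> ->].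
- move=> f IHf h IHh /andP[qf qh] /andP[rf rh].
  case: (IHf qf rf) => [gf|gf].
    by left; apply: generically_sub gf => v /= ->.
  case: (IHh qh rh) => [gh|gh].
    by left; apply: generically_sub gh => v /= ->; rewrite orbT.
  right; apply: generically_sub (generically_setI gf gh) => v /= [nf nh].
  by case/orP.
- move=> f IHf h IHh /andP[qf qh] /andP[rf rh].
  case: (IHf qf rf) => [gf|gf]; last first.
    by left; apply: generically_sub gf => v /= /negP/negPf->.
  case: (IHh qh rh) => [gh|gh].
    by left; apply: generically_sub gh => v /= ->; rewrite implybT.
  right; apply: generically_sub (generically_setI gf gh) => v /= [-> nh].
  exact: nh.
- move=> f IHf /IHf{}IHf /IHf[gf|gf]; [right|left];
    apply: generically_sub gf => v /=; first by move=> ->.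
  by move/negP.
Qed.

(** Quantifier elimination reduces every first-order property in the language
    of rings to the previous case: over an algebraically closed field,
    definable sets are constructible. *)
Lemma formula_generically_decided (f : GRing.formula K) :
  GRing.rformula f -> generically_decided [set v | GRing.holds (env v) f].
Proof.
move=> rf; pose axiom := @solve_monicpoly K.
pose wf := @ClosedFieldQE.wf_ex_elim K.
pose ok := ClosedFieldQE.holds_ex_elim axiom.
have /andP[qe_qf qe_rf] := GRing.quantifier_elim_wf wf rf.
rewrite (_ : [set v | _] = [set v | GRing.qf_eval (env v)
    (GRing.quantifier_elim (@ClosedFieldQE.ex_elim K) f)]).
  exact: qf_generically_decided.
by apply/seteqP; split=> v /= /(GRing.quantifier_elim_rformP wf ok _ rf).
Qed.

End Generic.
Arguments generically {K n} P.
Arguments generically_decided {K n} P.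

(** * Images of algebraic sets *)

Section Image.
Variables (K : closedFieldType) (n m : nat).

(** The variables of p are read in the environment from position k on: this
    leaves room for the free variables of the formula below. *)
Definition term_of (k : nat) (p : {mpoly K[m]}) : GRing.term K :=
  \big[GRing.Add/GRing.Const 0]_(d <- msupp p)
    GRing.Mul (GRing.Const (mcoeff d p))
      (\big[GRing.Mul/GRing.Const 1]_(i < m)
        GRing.Exp (GRing.Var K (k + i)) (d i)).

Lemma rterm_of k p : GRing.rterm (term_of k p).
Proof.
rewrite /term_of (big_morph (@GRing.rterm K) (id1 := true) (op1 := andb)) //.
elim/big_ind: _ => // [a b -> ->|d _] //=.
by elim/big_ind: _ => // a b /= -> ->.
Qed.

Lemma eval_term_of e k p :
  GRing.eval e (term_of k p) = p.@[fun i => e`_(k + i)].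
Proof.
rewrite mevalE /term_of.
rewrite (big_morph (GRing.eval e) (id1 := 0) (op1 := +%R)) //.
apply: eq_bigr => d _ /=; congr (_ * _).
by rewrite (big_morph (GRing.eval e) (id1 := 1) (op1 := *%R)).
Qed.

Lemma holds_conj (T : eqType) (s : seq T) e (F : T -> GRing.formula K) :
  GRing.holds e (\big[GRing.And/GRing.True]_(x <- s) F x) <->
  forall x, x \in s -> GRing.holds e (F x).
Proof.
elim: s => [|x s IHs]; first by rewrite big_nil.
rewrite big_cons /=; split=> [[Fx /IHs Fs] y|Fs].
  by rewrite inE => /orP[/eqP->|/Fs].
split; first exact: (Fs x (mem_head x s)).
by apply/IHs => y ys; apply: Fs; rewrite inE ys orbT.
Qed.

Lemma rformula_conj T (s : seq T) (F : T -> GRing.formula K) :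
  (forall x, GRing.rformula (F x)) ->
  GRing.rformula (\big[GRing.And/GRing.True]_(x <- s) F x).
Proof. by move=> rF; elim/big_ind: _ => // f h /= -> ->. Qed.

(** Chevalley's theorem, in the form of a dichotomy.  The image is defined by
    the formula stating that there is a solution u of the equations s such that
    v = phi u; v occupies the variables 0, ..., n - 1 and u the next m ones. *)
Theorem image_generically_decided (s : seq {mpoly K[m]})
    (phi : 'I_n -> {mpoly K[m]}) :
  generically_decided [set v : 'I_n -> K | exists u : 'I_m -> K,
    (forall f, f \in s -> f.@[u] = 0) /\ forall i, v i = (phi i).@[u]].
Proof.
pose body := GRing.And
  (\big[GRing.And/GRing.True]_(f <- s)
     GRing.Equal (term_of n f) (GRing.Const 0))
  (\big[GRing.And/GRing.True]_(i <- enum 'I_n)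
     GRing.Equal (GRing.Var K i) (term_of n (phi i))).
pose form := foldr GRing.Exists body (iota n m).
have rform : GRing.rformula form.
  rewrite /form; elim: (iota n m) => //=.
  by rewrite !rformula_conj // => [i|f] /=; rewrite rterm_of.
rewrite (_ : [set v | _] = [set v | GRing.holds (env v) form]).
  exact: formula_generically_decided.
apply/seteqP; split=> v /=.
  move=> [u [su uv]]; apply/GRing.foldExistsP.
  exists (env v ++ env u) => [i|].
    rewrite inE /= mem_iota nth_cat size_map size_enum_ord.
    have [//|le_ni] := ltnP i n; rewrite -leqNgt => le_nmi.
    by rewrite !nth_default // size_map size_enum_ord // leq_subRL.
  have eu p : p.@[fun i : 'I_m => (env v ++ env u)`_(n + i)] = p.@[u].
    apply: meval_eq => i; rewrite nth_cat size_map size_enum_ord.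
    by rewrite ltnNge leq_addr /= addKn nth_env.
  split; apply/holds_conj; [move=> f fs | move=> i _];
    rewrite /= eval_term_of eu; first exact: su.
  by rewrite nth_cat size_map size_enum_ord ltn_ord nth_env.
move=> /GRing.foldExistsP[e ev [/holds_conj es /holds_conj ephi]].
exists (fun i => e`_(n + i)); split=> [f /es|i].
  by rewrite /= eval_term_of.
have := ephi i (mem_enum _ _); rewrite /= eval_term_of => <-.
rewrite -(ev i) ?nth_env //.
by rewrite inE /= mem_iota leqNgt ltn_ord.
Qed.

End Image.

(** * Coordinatewise products of solutions *)

Section Products.
Variables (K : closedFieldType) (n : nat).
Implicit Types (s : seq {mpoly K[n]}) (v w x : 'I_n -> K).

Definition products s k : set ('I_n -> K) :=
  [set w | exists u : 'I_k -> 'I_n -> K,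
    (forall j f, f \in s -> f.@[u j] = 0) /\ forall i, w i = \prod_j u j i].

(** A k-tuple of solutions of s is a solution of one system in the k * n
    variables X_(j, i), and the product map is polynomial. *)
Lemma products_generically_decided s k : generically_decided (products s k).
Proof.
pose m := #|{: 'I_k * 'I_n}|.
pose var j i : {mpoly K[m]} := 'X_(enum_rank (j, i)).
pose s' := [seq comp_mpoly [tuple var j i | i < n] f | f <- s, j <- enum 'I_k].
have := image_generically_decided s' (fun i => \prod_j var j i).
rewrite (_ : [set v | _] = products s k) //; apply/seteqP; split=> w /=.
  move=> [y [s'y yw]]; exists (fun j i => y (enum_rank (j, i))).
  split=> [j f fs|i].
    have := s'y (comp_mpoly [tuple var j i | i < n] f).
    rewrite comp_mpoly_meval => <-; last first.
      by apply/allpairsP; exists (f, j); rewrite /= mem_enum.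
    by apply: meval_eq => i; rewrite tnth_map tnth_ord_tuple mevalXU.
  rewrite yw rmorph_prod /=; apply: eq_bigr => j _; exact: mevalXU.
move=> [u [su uw]]; exists (fun r => u (enum_val r).1 (enum_val r).2).
split=> [_ /allpairsP[[f j] /= [fs _ ->]]|i].
  rewrite comp_mpoly_meval -(su j f fs); apply: meval_eq => i.
  by rewrite tnth_map tnth_ord_tuple mevalXU enum_rankK.
rewrite uw rmorph_prod /=; apply: eq_bigr => j _.
by rewrite mevalXU enum_rankK.
Qed.

Lemma productsM s k l v w :
  products s k v -> products s l w -> products s (k + l) (fun i => v i * w i).
Proof.
move=> [a [sa av]] [b [sb bw]].
exists (fun j => match split j with inl j1 => a j1 | inr j2 => b j2 end).
split=> [j f fs|i]; first by case: (split j) => j'; [exact: sa | exact: sb].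
rewrite big_split_ord av bw; congr (_ * _); apply: eq_bigr => j _.
  by rewrite -[lshift _ _]/(unsplit (inl _ j)) unsplitK.
by rewrite -[rshift _ _]/(unsplit (inr _ j)) unsplitK.
Qed.

Lemma generically_torus : generically [set v : 'I_n -> K | forall i, v i != 0].
Proof.
exists (\prod_i 'X_i : {mpoly K[n]}); last first.
  move=> v; rewrite rmorph_prod /= => /prodf_neq0 vi i.
  by have := vi i isT; rewrite mevalXU.
apply/eqP => /(congr1 (meval (fun=> 1))); rewrite rmorph_prod meval0.
under eq_bigr do rewrite /= mevalXU.
by rewrite big1_eq => /eqP; rewrite oner_eq0.
Qed.

(** If P contains the locus g <> 0, then the preimage of P under v |-> x / v
    contains the locus h <> 0, where h is the numerator of g (x / v): clearing
    denominators with the d-th power of each variable gives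
    h (v) = (\prod_i v_i ^ d) * g (x / v).  This h is not the zero polynomial,
    since division into x is an involution of the torus: h does not vanish at
    x / y when y is a point of the torus with g (y) <> 0. *)
Lemma generically_divide x (P : set ('I_n -> K)) : (forall i, x i != 0) ->
  generically P -> generically [set v | P (fun i => x i / v i)].
Proof.
move=> x0 gP; have gPT := generically_setI gP generically_torus.
case: gP => g g0 gP; pose d := msize g.
have dm m i : m \in msupp g -> (m i <= d)%N.
  move=> mg; rewrite ltnW // (leq_ltn_trans _ (msize_mdeg_lt mg)) //.
  by rewrite mdegE (bigD1 i) //= leq_addr.
pose h : {mpoly K[n]} := \sum_(m <- msupp g)
  (mcoeff m g * \prod_i x i ^+ m i) *: \prod_i 'X_i ^+ (d - m i).
have hE v : (forall i, v i != 0) ->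
    h.@[v] = (\prod_i v i ^+ d) * g.@[fun i => x i / v i].
  move=> v0; rewrite [in RHS]mevalE mulr_sumr raddf_sum.
  apply: eq_big_seq => m mg.
  rewrite /= mevalZ -mulrA [RHS]mulrCA; congr (_ * _).
  rewrite rmorph_prod -!big_split /=; apply: eq_bigr => i _.
  rewrite rmorphXn /= mevalXU expr_div_n mulrCA; congr (_ * _).
  by rewrite -(subnK (dm m i mg)) exprD addnK mulfK // expf_neq0.
have h0 : h != 0.
  have gnz : generically [set v | g.@[v] != 0] by exists g.
  have [y [gy y0]] :=
    generically_nonempty (generically_setI gnz generically_torus).
  have xy0 i : x i / y i != 0 by rewrite mulf_neq0 ?invr_neq0.
  have xyK i : x i / (x i / y i) = y i by rewrite invf_div mulrCA mulfV ?mulr1.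
  apply/eqP => h0; have := hE _ xy0; rewrite h0 meval0 => /esym/eqP/negP; apply.
  apply/negP; rewrite mulf_neq0 ?(meval_eq g xyK) //; apply/prodf_neq0 => i _.
  by rewrite expf_neq0.
have hnz : generically [set v | h.@[v] != 0] by exists h.
apply: generically_sub (generically_setI hnz generically_torus).
move=> v [/= hv v0]; apply: gP; move: hv; rewrite hE //.
by apply: contraNneq => ->; rewrite mulr0.
Qed.

End Products.

(** * Hadamard ranks in coordinates *)

Lemma meval_scale (A : comNzRingType) n d (f : {mpoly A[n]}) c
    (v w : 'I_n -> A) :
  f \is @ishomog1 n A d mdeg -> (forall i, w i = c * v i) ->
  f.@[w] = c ^+ d * f.@[v].
Proof.
move=> /dhomogP hf wv; rewrite !mevalE mulr_sumr.
apply: eq_big_seq => m /hf <-; rewrite mulrCA; congr (_ * _).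
rewrite /= mdegE -prodrXr -big_split /=; apply: eq_bigr => i _.
by rewrite wv exprMn.
Qed.

Section Least.
Variable R : realType.
Implicit Type P : set nat.

Lemma least_le P n : P n -> (@least R P <= n%:R%:E)%E.
Proof.
move=> Pn; rewrite /least.
case: pselect => [exP|[]]; last by exists n; apply/asboolP.
by case: ex_minnP => k _ kmin; rewrite lee_fin ler_nat; apply/kmin/asboolP.
Qed.

Lemma least_fin P :
  (@least R P < +oo)%E -> exists2 n, P n & @least R P = n%:R%:E.
Proof.
rewrite /least; case: pselect => [exP _|_]; last by rewrite ltxx.
by case: ex_minnP => n /asboolP Pn _; exists n.
Qed.

Lemma least_leP P m : (@least R P <= m%:R%:E)%E -> exists2 n, (n <= m)%N & P n.
Proof.
move=> Pm; have [n Pn Pe] := least_fin (le_lt_trans Pm (ltry _)).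
by exists n => //; move: Pm; rewrite Pe lee_fin ler_nat.
Qed.

End Least.

Section Projective.
Variables (R : realType) (N : nat).
Local Notation K := R[i].
Local Notation PN := (proj R N).
Implicit Types (p q : PN) (X S : set PN).

Lemma point_ofP (v : 'rV[K]_N.+1) p :
  point_of v = Some p <-> exists2 c, c != 0 & v = c *: coords p.
Proof.
split=> [|[c c0 ->]].
  rewrite /point_of; case: insubP => //= u _ <- [<-].
  have [c c0 ->] := coordsP u; exists c^-1; first by rewrite invr_eq0.
  by rewrite scalerA mulVf ?scale1r.
by rewrite point_of_scale // /point_of /coords valK /= reprK.
Qed.

(** A partial product that is undefined has all its coordinates zero, hence so
    does the full product: evaluating from the left loses nothing. *)
Lemma hadamard_seqE p (s : seq PN) :
  hadamard_seq (p :: s) = point_of (\row_i \prod_(q <- p :: s) coords q 0 i).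
Proof.
elim/last_ind: s => [|s q IHs].
  apply/esym/point_ofP; exists 1; rewrite ?oner_neq0 // scale1r.
  by apply/rowP => i; rewrite mxE big_seq1.
rewrite /= foldl_rcons -/(hadamard_seq (p :: s)) IHs.
case E : (point_of _) => [r|] /=.
  have [c c0 /rowP rE] := (point_ofP _ _).1 E.
  rewrite /hadamard -(point_of_scale _ c0); congr point_of; apply/rowP => i.
  rewrite !mxE -rcons_cons big_rcons /=.
  by have := rE i; rewrite !mxE => ->; rewrite mulrA.
move: E; rewrite /point_of; case: insubP => //= /negPn/eqP/rowP E _.
rewrite (_ : \row_i _ = 0) ?insubF ?eqxx //.
apply/rowP => i; have := E i.
by rewrite !mxE -rcons_cons big_rcons /= => ->; rewrite mul0r.
Qed.

Lemma hadamard_tupleE k (t : k.+1.-tuple PN) :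
  hadamard_seq t = point_of (\row_i \prod_(q <- t) coords q 0 i).
Proof. by case/tupleP: t => p t; rewrite hadamard_seqE. Qed.

Lemma coords_pi (v : 'I_N.+1 -> K) i : v i != 0 ->
  exists p : PN, exists2 c, c != 0 & forall j, coords p 0 j = c * v j.
Proof.
move=> vi; have v0 : \row_j v j != 0 :> 'rV[K]_N.+1.
  by apply: contraNneq vi => /rowP/(_ i); rewrite !mxE => ->.
have [c c0 pE] := coordsP (exist (fun w => w != 0) _ v0).
exists (\pi_PN (exist (fun w => w != 0) _ v0))%qT, c => // j.
by rewrite pE !mxE.
Qed.

Lemma finite_homogeneous_equations X : zariski_closed X ->
  exists2 s : seq {mpoly K[N.+1]}, (forall f, f \in s -> homogeneous f) &
    forall p, X p <-> forall f, f \in s -> vanishes f p.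
Proof.
move=> [I homI ->]; have [s sI Is] := finite_equations I.
exists s => [f /sI|p]; first exact: homI.
by split=> [pI f /sI/pI//|/Is].
Qed.

Lemma vanishes_scale (f : {mpoly K[N.+1]}) p c (v : 'I_N.+1 -> K) :
  homogeneous f -> c != 0 -> (forall i, v i = c * coords p 0 i) ->
  vanishes f p <-> f.@[v] = 0.
Proof.
move=> [d hf] c0 vE; rewrite (meval_scale hf vE) /vanishes.
split=> [->|/eqP]; rewrite ?mulr0 // mulf_eq0 expf_eq0 (negPf c0) andbF.
by move/eqP.
Qed.

Section Rank.
Variables (X : set PN) (s : seq {mpoly K[N.+1]}).
Hypothesis s_homog : forall f, f \in s -> homogeneous f.
Hypothesis XE : forall p, X p <-> forall f, f \in s -> vanishes f p.

(** Since the product w represents a point, none of its factors is zero, so each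
    of them represents a point of X. *)
Lemma Hrk_le_products k (w : 'I_N.+1 -> K) p : (0 < k)%N ->
  products s k w -> (forall i, coords p 0 i = w i) -> (Hrk X p <= k%:R%:E)%E.
Proof.
move=> k0 [u [su uw]] pw; apply: least_le; split=> //.
have [i0 pi0] : exists i, coords p 0 i != 0 by apply/rV0Pn; exact: coords_neq0.
have ui0 j : u j i0 != 0 by move: pi0; rewrite pw uw => /prodf_neq0/(_ j isT).
have /choice[q /choice[c qE]] : forall j, exists q : PN, exists c,
    c != 0 /\ forall i, coords q 0 i = c * u j i.
  by move=> j; have [q [c c0 qE]] := coords_pi (ui0 j); exists q, c.
exists [tuple q j | j < k]; split=> [j|].
  rewrite tnth_map tnth_ord_tuple; apply/XE => f fs.
  have [c0 qcE] := qE j.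
  apply/(vanishes_scale (c := (c j)^-1) (v := u j) (s_homog fs)).
  - by rewrite invr_eq0.
  - by move=> i; rewrite qcE mulKf.
  - exact: su.
case: k k0 => // k _ in u su uw ui0 q c qE *.
rewrite hadamard_tupleE; apply/point_ofP; exists (\prod_j c j).
  by apply/prodf_neq0 => j _; have [] := qE j.
apply/rowP => i; rewrite !mxE pw uw big_tuple -big_split; apply: eq_bigr => j _.
by rewrite tnth_map tnth_ord_tuple; have [_ ->] := qE j.
Qed.

Lemma products_Hrk_le m p a : (Hrk X p <= m%:R%:E)%E -> a != 0 ->
  exists k,
    [/\ (0 < k)%N, (k <= m)%N & products s k (fun i => a * coords p 0 i)].
Proof.
move=> /least_leP[k km [k0 [q [Xq qp]]]] a0; exists k; split=> //.
case: k k0 q Xq qp {km} => // k _ q Xq qp.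
have [c c0 /rowP cE] : exists2 c, c != 0 &
    \row_i \prod_(r <- q) coords r 0 i = c *: coords p.
  by apply/point_ofP; rewrite -hadamard_tupleE.
(* The product of the chosen coordinates is only proportional to the prescribed
   representative; the first factor absorbs the scalar. *)
pose b (j : 'I_k.+1) := if j == ord0 then a / c else 1.
have b0 j : b j != 0.
  by rewrite /b; case: ifP; rewrite ?oner_neq0 ?mulf_neq0 ?invr_neq0.
exists (fun j i => b j * coords (tnth q j) 0 i); split=> [j f fs|i].
  exact/(vanishes_scale (s_homog fs) (b0 j) (fun i => erefl))/((XE _).1 (Xq j)).
have := cE i; rewrite !mxE big_tuple big_split /= => ->.
by rewrite big_ord_recl /b eqxx big1 ?mulr1 ?mulrA ?divfK.
Qed.

End Rank.

(** A polynomial g that vanishes on the cone over S need not be homogeneous, but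
    all its homogeneous components vanish on that cone: on a line through the
    origin, g is a polynomial in the scaling factor, with the values of the
    components as coefficients.  So the components are equations of S, and they
    cannot all vanish everywhere. *)
Lemma zariski_dense_generic S (P : set ('I_N.+1 -> K)) :
  zariski_closure S = setT -> generically P ->
  exists p, exists2 a, S p /\ a != 0 & P (fun i => a * coords p 0 i).
Proof.
move=> Sdense [g g0 gP].
apply: contrapT => noP.
pose gd d : {mpoly K[N.+1]} := pihomog mdeg d g.
have gdh d : gd d \is @ishomog1 _ _ d mdeg by exact: pihomogP.
have gE : g = \sum_(d < msize g) gd d by exact: pihomog_partitionE.
pose Z : set PN := [set p | forall f, [set gd d | d in setT] f -> vanishes f p].
have Zclosed : zariski_closed Z.
  by exists [set gd d | d in setT] => // _ [d _ <-]; exists d.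
have SZ : S `<=` Z.
  move=> p Sp _ [d _ <-]; rewrite /vanishes.
  pose r := \poly_(e < msize g) (gd e).@[coords p 0].
  have ra a : a != 0 -> r.[a] = 0.
    move=> a0; have [//|ga] := eqVneq r.[a] 0; case: noP; exists p, a => //.
    apply: gP; rewrite gE raddf_sum /=; move: ga; rewrite horner_poly.
    congr (_ != 0); apply: eq_bigr => e _; rewrite mulrC; apply/esym.
    exact: (meval_scale (gdh e)).
  have r0 : r = 0.
    apply/eqP/negbNE/negP => r0.
    (* The factor 'X discards the root a = 0, where r is not controlled. *)
    have /closed_nonrootP[a] : 'X * r != 0 by rewrite mulf_neq0 ?polyX_eq0.
    rewrite rootE hornerM hornerX mulf_eq0 negb_or => /andP[a0].
    by rewrite ra ?eqxx.
  have := congr1 (fun q : {poly K} => q`_d) r0; rewrite coef_poly coef0.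
  case: ltnP => // gd_big _.
  rewrite [gd d]pihomogE big_seq_cond big1 ?meval0 // => e /andP[eg /eqP ed].
  by move: (msize_mdeg_lt eg); rewrite ed ltnNge gd_big.
have ZT : setT `<=` Z by rewrite -Sdense; exact: smallest_sub.
have gnz : generically [set v | g.@[v] != 0] by exists g.
have [v [gv v0]] :=
  generically_nonempty (generically_setI gnz (@generically_torus _ _)).
have [p [c c0 pE]] := coords_pi (v0 ord0).
case/negP: gv; rewrite gE raddf_sum /= big1 // => d _.
apply/(vanishes_scale (p := p) (c := c^-1)).
- by exists d.
- by rewrite invr_eq0.
- by move=> i; rewrite pE mulKf.
- by apply: ZT => //; exists (val d).
Qed.

End Projective.

(** * Torus points *)

Unset Implicit Arguments.

Theorem proposition3p11 (R : realType) (N : nat) (X : set (proj R N))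
    (X_irr : irreducible_variety X)
    (X_fin : (generic_Hrk X < +oo)%E)
    (x : proj R N) (x_torus : \prod_i coords x 0 i != 0) :
  (Hrk X x <= 2%:E * generic_Hrk X)%E.
Proof.
have [X_closed _ _] := X_irr.
have [s s_homog XE] := finite_homogeneous_equations X_closed.
have [m [_ m_dense] mE] := least_fin X_fin; rewrite [generic_Hrk X]mE {mE}.
have [k [k0 km gk]] : exists k,
    [/\ (0 < k)%N, (k <= m)%N & generically (products s k)].
  apply: contrapT => nok.
  have gn : generically [set w | forall k,
      (0 < k)%N -> (k <= m)%N -> ~ products s k w].
    have gnk k : (0 < k)%N -> (k <= m)%N -> generically (~` products s k).
      move=> k0 km; have [gk|//] := products_generically_decided s k.
      by case: nok; exists k.
    elim: m {m_dense nok} gnk => [|m IHm] gnk.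
      by apply: generically_sub (generically_setT _ _) => w _ [].
    have := generically_setI (gnk m.+1 isT (leqnn _))
      (IHm (fun k k0 km => gnk k k0 (leqW km))).
    apply: generically_sub => w [nw /= IHw] k k0.
    rewrite leq_eqVlt => /orP[/eqP->//|].
    exact: IHw.
  have [p [a [Sp a0] np]] := zariski_dense_generic m_dense gn.
  have [k [k0 km]] := products_Hrk_le s_homog XE Sp a0.
  exact: np.
have x0 i : coords x 0 i != 0 by move/prodf_neq0: x_torus; apply.
have [u [[uk xuk] u0]] := generically_nonempty (generically_setI
  (generically_setI gk (generically_divide x0 gk)) (@generically_torus _ _)).
have xE i : coords x 0 i = u i * (coords x 0 i / u i).
  by rewrite mulrCA mulfV ?mulr1.
have kk0 : (0 < k + k)%N by rewrite addn_gt0 k0.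
apply: le_trans (Hrk_le_products s_homog XE kk0 (productsM uk xuk) xE) _.
by rewrite -EFinM lee_fin -natrM ler_nat mul2n -addnn leq_add.
Qed.
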